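(* Let $\Phi$ be a root system in a finite-dimensional real Euclidean space $V$, with finite reflection group $W$ and fixed simple system $\Pi$, and let $n\in\mathbb{N}$. Let $\mathcal{C}_W^{(n)}\subseteq V^n$ be the subset defined in the context. Then: (a) If $\mathbf{v}=(v_1,\dots,v_n)\in \mathcal{C}_W^{(n)}$, then $\operatorname{Stab}_W(\mathbf{v})=W_{\mathbf{v},n}$ is the standard parabolic subgroup $W_{I_{\mathbf{v}}}$ of $W$, where $I_{\mathbf{v}}=\{s_\alpha\mid \alpha\in\Pi,\ \langle\alpha,v_i\rangle=0\text{ for } i=1,\dots,n\}$. (b) Every $W$-orbit on $V^n$ (for the diagonal action) contains a unique point of $\mathcal{C}_W^{(n)}$. (c) $\mathcal{C}_W^{(n)}$ is a convex (and hence connected) subset of $V^n$.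
   Context: $V$ is a finite-dimensional real vector space with inner product $\langle-,-\rangle$. For $0\ne\alpha\in V$ put $\alpha^\vee=2\alpha/\langle\alpha,\alpha\rangle$ and $s_\alpha(v)=v-\langle v,\alpha^\vee\rangle\alpha$. A root system $\Phi$ in $V$ is a finite subset of $V\setminus\{0\}$ such that $s_\alpha(\beta)\in\Phi$ for all $\alpha,\beta\in\Phi$, and such that $\alpha,c\alpha\in\Phi$ with $c\in\mathbb{R}$ implies $c\in\{\pm1\}$ (it need not span $V$ or be crystallographic). $W$ is the (finite) group generated by $\{s_\alpha\mid\alpha\in\Phi\}$. A simple system $\Pi\subseteq\Phi$ is a linearly independent subset such that $\Phi=\Phi_+\sqcup\Phi_-$, where $\Phi_+=\Phi\cap\mathbb{R}_{\ge0}\Pi$ and $\Phi_-=-\Phi_+$; one is fixed. $S=\{s_\alpha\mid\alpha\in\Pi\}$. For $I\subseteq S$, $W_I=\langle I\rangle$ is a standard parabolic subgroup. For a subgroup $W'$ of $W$ generated by reflections $s_\alpha$ ($\alpha\in\Phi$), put $\Phi_{W'}=\{\alpha\in\Phi\mid s_\alpha\in W'\}$ and $\mathcal{C}_{W'}=\{v\in V\mid\langle v,\alpha\rangle\ge0\text{ for all }\alpha\in\Phi_{W'}\cap\Phi_+\}$. $W$ acts diagonally on $V^n$: $w(v_1,\dots,v_n)=(wv_1,\dots,wv_n)$ (with $V^0=\{0\}$). For $\mathbf{v}=(v_1,\dots,v_n)\in V^n$ and $0\le m\le n$ let $W_{\mathbf{v},m}=\operatorname{Stab}_W(v_1)\cap\dots\cap\operatorname{Stab}_W(v_m)$,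 so $W_{\mathbf{v},0}=W$; this is a subgroup generated by reflections. Define $$\mathcal{C}_W^{(n)}=\{\mathbf{v}=(v_1,\dots,v_n)\in V^n\mid v_m\in\mathcal{C}_{W_{\mathbf{v},m-1}}\text{ for } m=1,\dots,n\}.$$ *)

(* Defs.v *)
From HB Require Import structures.
From mathcomp Require Import all_boot all_order all_algebra finmap.
From mathcomp Require Import all_classical all_reals all_analysis.

Set Implicit Arguments.
Unset Strict Implicit.
Unset Printing Implicit Defensive.

Import Order.TTheory GRing.Theory Num.Theory.
Import numFieldNormedType.Exports.

Local Open Scope classical_set_scope.
Local Open Scope ring_scope.

Section LinearGroups.
Context {R : realType} {V : vectType R}.
Implicit Types (G S : set 'End(V)) (x : V).

(* Subgroups of GL(V). f^-1 is a total operation on 'End(V), and it is the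
   inverse of f exactly when f has trivial kernel. *)
Definition linear_group G : Prop :=
  [/\ G \1%VF,
      forall f g, G f -> G g -> G (f \o g)%VF &
      forall f, G f -> lker f == 0%VS /\ G (f^-1)%VF].

Definition generated S : set 'End(V) := smallest linear_group S.

Definition stab G x : set 'End(V) := [set w | G w /\ w x = x].

Definition diag_act n (w : 'End(V)) (v : V ^ n) : V ^ n :=
  [ffun i => w (v i)].

Definition diag_orbit n G (v : V ^ n) : set (V ^ n) :=
  [set diag_act w v | w in G].

Definition diag_stab n G (v : V ^ n) : set 'End(V) :=
  [set w | G w /\ diag_act w v = v].

(* The leading G only matters when m = 0, where the intersection is over no
   index at all. *)
Definition prefix_stab n G (v : V ^ n) (m : nat) : set 'End(V) :=
  G `&` \bigcap_(i in [set i : 'I_n | (i < m)%N]) stab G (v i).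

End LinearGroups.

Section RootSystems.
Context {R : realType} {V : vectType R}.
Variable dp : {dot V for idfun}.
Implicit Types (Phi Pi : {fset V}) (G : set 'End(V)).

Definition coroot (a : V) : V := (2 / dp a a) *: a.

Definition reflection_fun (a v : V) : V := v - dp v (coroot a) *: a.

Fact reflection_fun_is_linear a : linear (reflection_fun a).
Proof.
move=> k u v; rewrite /reflection_fun linearPl /= scalerDl -scalerA.
by rewrite scalerBr opprD addrACA.
Qed.

HB.instance Definition _ a := GRing.isLinear.Build R V V *:%R
  (reflection_fun a) (reflection_fun_is_linear a).

Definition reflection (a : V) : 'End(V) := linfun (reflection_fun a).

Lemma reflectionE a v : reflection a v = v - dp v (coroot a) *: a.
Proof. by rewrite lfunE. Qed.

Record root_system Phi : Prop := RootSystem {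
  root_neq0 : 0 \notin Phi;
  root_reflection : {in Phi &, forall a b, reflection a b \in Phi};
  root_reduced : forall a (c : R),
    a \in Phi -> c *: a \in Phi -> c = 1 \/ c = -1
}.

Definition weyl_group Phi : set 'End(V) :=
  generated [set reflection a | a in [set` Phi]].

Definition cone Pi : set V :=
  [set v | exists2 c : V -> R, (forall a, a \in Pi -> 0 <= c a) &
           v = \sum_(a <- Pi) c a *: a].

Definition positive_roots Phi Pi : set V := [set` Phi] `&` cone Pi.

Definition negative_roots Phi Pi : set V :=
  [set - a | a in positive_roots Phi Pi].

Record simple_system Phi Pi : Prop := SimpleSystem {
  simple_sub : {subset Pi <= Phi};
  simple_free : free Pi;
  simple_cover : [set` Phi] = positive_roots Phi Pi `|` negative_roots Phi Pi;
  simple_disjoint : positive_roots Phi Pi `&` negative_roots Phi Pi = set0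
}.

Definition subgroup_roots Phi G : set V :=
  [set a | a \in Phi /\ G (reflection a)].

Definition chamber Phi Pi G : set V :=
  [set v | forall a, (subgroup_roots Phi G `&` positive_roots Phi Pi) a ->
           0 <= dp v a].

(* With 0-based indices, v m is the (m+1)-st component of v, and
   prefix_stab _ v m fixes the m components before it. *)
Definition chamber_n n Phi Pi : set (V ^ n) :=
  [set v | forall m : 'I_n,
           chamber Phi Pi (prefix_stab (weyl_group Phi) v m) (v m)].

Definition orthogonal_simple_reflections n Pi (v : V ^ n) : set 'End(V) :=
  [set reflection a | a in [set a | a \in Pi /\ forall i, dp a (v i) = 0]].

End RootSystems.

(* The topology of a finite-dimensional real vector space is pulled back from
   R^d along the coordinates in a basis; it does not depend on the basis. *)
Definition euclidean {R : realType} (E : vectType R) : Type :=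
  initial_topology (passmx.rVof (vbasis {:E})).

HB.instance Definition _ (R : realType) (E : vectType R) :=
  Topological.on (@euclidean R E).

(* Main.v *)
Require Import Defs.
From HB Require Import structures.
From mathcomp Require Import all_boot all_order all_algebra finmap.
From mathcomp Require Import all_classical all_reals all_analysis.
From mathcomp Require Import ring.

Set Implicit Arguments.
Unset Strict Implicit.
Unset Printing Implicit Defensive.

Import Order.TTheory GRing.Theory Num.Theory.

Local Open Scope classical_set_scope.
Local Open Scope ring_scope.

(** Attach to [v] in [V^n] and to a vector [a] the row of scalar products
    [(<v_1,a>, ..., <v_n,a>)].  The reflection [s_a] lies in the stabiliser of
    [v_1, ..., v_m] exactly when the first [m] entries of this row vanish, so
    the recursive definition of the chamber in [V^n], taken over all [m] at
    once, says that for every positive root [a] this row is nonnegative in the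
    lexicographic order of [R^n] ([chamber_n_dominant]).  The lexicographically
    nonnegative rows form a convex cone that contains [x] or [-x] for every [x],
    and both only for [x = 0].  Hence [a |-> (<v_i,a>)_i] may be treated like
    the pairing with a single vector, taking values in a totally ordered vector
    space instead of [R], and the classical argument that a closed Weyl chamber
    is a strict fundamental domain applies, with no induction on [n] and no
    passage to parabolic subgroups.

    Convexity is then immediate, and connectedness follows from it.  Positivity
    on the positive roots reduces to positivity on the simple ones.  If [v] is
    negative on a simple root [a], then [s_a] strictly decreases the number of
    positive roots on which [v] is negative, because [s_a] permutes the positive
    roots other than [a]; this gives a dominant point in each orbit
    ([dominant_orbit]).

    For uniqueness and stabilisers, let [v] and [w v] be dominant, with [w]
    written as a word [w = u s_a] in simple reflections.  If [w a] is positive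
    then [u a] is negative and the exchange property provides a shorter word
    for [w].  Otherwise [(<v_i,a>)_i] is both nonnegative and nonpositive, so it
    is zero, [s_a] fixes [v], and [u] takes the place of [w].  By induction on
    the length, [w] fixes [v] and is a product of simple reflections that fix
    [v] ([dominant_word_fix]).  That simple reflections generate [W] comes from
    [dominant_orbit] in the case [n = 1]: moving the negative of a positive root
    into the chamber turns the root itself negative, and the root is simple at
    the step where it changes sign. *)

(** * Convex sets are connected *)

Section Connectedness.
Import numFieldNormedType.Exports passmx.
Context {R : realType}.

Lemma line_continuous (E : vectType R) (x d : E) :
  continuous ((fun t : R => x + t *: d) : R -> euclidean E).
Proof.
apply: continuous_comp_initial => t /=.
have -> : rVof (vbasis {:E}) \o (fun t : R => x + t *: d) =
  (fun t : R => rVof (vbasis {:E}) x +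
                  t *: rVof (vbasis {:E}) d).
  by apply/funext => r /=; rewrite linearD linearZ.
apply: cvgD; first exact: cvg_cst.
by apply: cvgZr_tmp; exact: cvg_id.
Qed.

(** The set is the union of the segments joining its points to a fixed one. *)
Lemma convex_connected (E : vectType R) (A : set E) :
  convex_set (A : set (convex_lmodType E)) ->
  connected (A : set (euclidean E)).
Proof.
move=> cA; have [[y Ay]|A0] := pselect (A !=set0); last first.
  have -> : A = set0 by apply/seteqP; split => // x Ax; apply: A0; exists x.
  exact: connected0.
pose seg (x : E) : set (euclidean E) :=
  (fun t : R => y + t *: (x - y)) @` `[0, 1].
have -> : (A : set (euclidean E)) = \bigcup_(x in A) seg x.
  apply/seteqP; split => [x Ax | z [x Ax [t /= t01 <-]]].
    exists x => //; exists 1; first by rewrite /= in_itv /= ler01 lexx.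
    by rewrite scale1r addrC subrK.
  have t0 : 0 <= t by move: t01; rewrite in_itv /= => /andP[].
  have t1 : t <= 1 by move: t01; rewrite in_itv /= => /andP[].
  have := cA x y (Itv01 t0 t1) (mem_set Ax) (mem_set Ay).
  move/set_mem; rewrite /conv /= scalerBl scale1r.
  by rewrite addrCA -scalerBr.
apply: bigcup_connected.
  exists y => x Ax; exists 0; first by rewrite /= in_itv /= lexx ler01.
  by rewrite scale0r addr0.
move=> x Ax; apply: connected_continuous_connected.
  by apply: (@segment_connected R).
apply: continuous_subspaceT; exact: line_continuous.
Qed.

End Connectedness.

(** * The lexicographic cone *)

Section LexCone.
Context {R : realType} {n : nat}.
Implicit Types x y : R^o ^ n.

(** Past the first nonzero entry the premise fails, so the condition says that
    this entry, if there is one, is positive. *)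
Definition lex_ge0 x :=
  forall m : 'I_n, (forall i : 'I_n, (i < m)%N -> x i = 0) -> 0 <= x m.

Lemma lex_ge0_0 : lex_ge0 0.
Proof. by move=> m _; rewrite ffunE. Qed.

(** Two nonnegative entries with zero sum vanish, so below the first nonzero
    entry of the sum both rows are zero. *)
Lemma lex_ge0D x y : lex_ge0 x -> lex_ge0 y -> lex_ge0 (x + y).
Proof.
move=> x0 y0 m xy0.
suff xym k : (k <= m)%N -> forall i : 'I_n, (i < k)%N -> x i = 0 /\ y i = 0.
  by rewrite ffunE addr_ge0 ?x0 ?y0 // => i /(xym m (leqnn m))[].
elim: k => // k IH km i; rewrite ltnS leq_eqVlt => /predU1P[ik|]; last first.
  exact: IH (ltnW km) i.
have ltik (j : 'I_n) : (j < i)%N -> x j = 0 /\ y j = 0.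
  by rewrite ik; apply: IH; exact: ltnW.
have xi : 0 <= x i by apply: x0 => j /ltik[].
have yi : 0 <= y i by apply: y0 => j /ltik[].
have : x i + y i = 0 by move: (xy0 i); rewrite ffunE ik; apply.
by move/eqP; rewrite paddr_eq0 // => /andP[/eqP -> /eqP ->].
Qed.

Lemma lex_ge0Z (c : R) x : 0 <= c -> lex_ge0 x -> lex_ge0 (c *: x).
Proof.
rewrite le_eqVlt => /predU1P[<- _|c0 x0 m cx0].
  by rewrite scale0r; exact: lex_ge0_0.
rewrite ffunE /= mulr_ge0 ?(ltW c0) //; apply: x0 => i /cx0 /eqP.
by rewrite ffunE /= mulf_eq0 gt_eqF //= => /eqP.
Qed.

Lemma lex_ge0_sum (I : eqType) (r : seq I) (F : I -> R^o ^ n) :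
  (forall i, i \in r -> lex_ge0 (F i)) -> lex_ge0 (\sum_(i <- r) F i).
Proof.
move=> F0; rewrite big_seq; elim/big_ind: _ => //; first exact: lex_ge0_0.
exact: lex_ge0D.
Qed.

Lemma lex_ge0_anti x : lex_ge0 x -> lex_ge0 (- x) -> x = 0.
Proof.
move=> x0 Nx0; apply/ffunP => i; rewrite [RHS]ffunE.
elim/ltn_ind: {i}(i : nat) {-2}i (erefl (i : nat)) => k IH i ik.
have lti (j : 'I_n) : (j < i)%N -> x j = 0.
  by move=> ji; apply: (IH j); rewrite -?ik.
apply/le_anti; rewrite x0 // andbT -oppr_ge0.
have := Nx0 i; rewrite ffunE; apply => j /lti.
by rewrite ffunE => ->; rewrite oppr0.
Qed.

Lemma lex_ge0_total x : lex_ge0 x \/ lex_ge0 (- x).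
Proof.
have [[i xi]|x0] := pselect (exists i, x i != 0); last first.
  left=> m _; rewrite [x m](_ : _ = 0) //; apply/eqP.
  by apply: contrapT => /negP xm; apply: x0; exists m.
(* The sign is decided at the first nonzero entry. *)
case: (@arg_minnP _ i (fun j => x j != 0) (@nat_of_ord n) xi) => j xj minj.
have zero (k : 'I_n) : (k < j)%N -> x k = 0.
  by move=> kj; apply: contraTeq kj => /minj; rewrite -leqNgt.
have lex_at (y : R^o ^ n) : (forall k, (y k == 0) = (x k == 0)) ->
    0 <= y j -> lex_ge0 y.
  move=> xy yj m ym; have [mj|jm|/val_inj -> //] := ltngtP m j.
    by have /eqP := zero _ mj; rewrite -xy => /eqP ->.
  by move/eqP: (ym j jm); rewrite xy (negPf xj).
have [xj0|xj0] := leP 0 (x j); [left|right]; apply: lex_at => //.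
  by move=> k; rewrite ffunE oppr_eq0.
by rewrite ffunE oppr_ge0 ltW.
Qed.

End LexCone.

(** * Words in reflections *)

Section Reflections.
Context {R : realType} {V : vectType R}.
Variable dp : {dot V for idfun}.
Implicit Types (a b x y : V).

Lemma dotC x y : dp x y = dp y x.
Proof. by rewrite hermC expr0 mul1r. Qed.

Lemma dotZl (c : R) x y : dp (c *: x) y = c * dp x y.
Proof. exact: linearZl_LR. Qed.

Lemma dotZr (c : R) x y : dp x (c *: y) = c * dp x y.
Proof. by rewrite dotC dotZl dotC. Qed.

Lemma dot_self_eq0 x : (dp x x == 0) = (x == 0).
Proof.
apply/idP/eqP => [xx0|->]; last by rewrite linear0l.
apply: contraTeq xx0 => x0; rewrite gt_eqF //; exact: neq0_dnorm_gt0.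
Qed.

Lemma reflection_dotE a x : reflection dp a x = x - (2 * dp x a / dp a a) *: a.
Proof. by rewrite reflectionE /coroot dotZr mulrAC. Qed.

Lemma reflection_root a : a != 0 -> reflection dp a a = - a.
Proof.
move=> a0; rewrite reflection_dotE mulfK ?dot_self_eq0 //.
by rewrite scaler_nat mulr2n opprD addNKr.
Qed.

Lemma reflection_isometry a x y :
  dp (reflection dp a x) (reflection dp a y) = dp x y.
Proof.
have [->|a0] := eqVneq a 0; first by rewrite !reflection_dotE !scaler0 !subr0.
have aa0 : dp a a != 0 by rewrite dot_self_eq0.
rewrite !reflection_dotE linearBl linearBr /= linearBr /= !dotZl !dotZr.
by rewrite !(dotC a); field.
Qed.

Lemma reflectionK a : involutive (reflection dp a).
Proof.
move=> x; have [->|a0] := eqVneq a 0.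
  by rewrite !reflection_dotE !scaler0 !subr0.
have ra : dp (reflection dp a x) a = - dp x a.
  have aa0 : dp a a != 0 by rewrite dot_self_eq0.
  by rewrite reflection_dotE linearBl /= dotZl; field.
rewrite [LHS]reflection_dotE ra mulrN mulNr scaleNr opprK.
by rewrite reflection_dotE subrK.
Qed.

Lemma reflection_sym a x y :
  dp (reflection dp a x) y = dp x (reflection dp a y).
Proof. by rewrite -{1}[y](reflectionK a) reflection_isometry. Qed.

Lemma reflectionN a : reflection dp (- a) = reflection dp a.
Proof.
apply/lfunP => x; rewrite !reflection_dotE hnormN linearNr /=.
by rewrite !(mulrN, mulNr) scaleNr scalerN opprK.
Qed.

Lemma reflection_fix a x : a != 0 -> reflection dp a x = x <-> dp x a = 0.
Proof.
move=> a0; rewrite reflection_dotE; split=> [/eqP|->]; last first.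
  by rewrite mulr0 mul0r scale0r subr0.
rewrite -subr_eq0 addrAC subrr sub0r oppr_eq0 scaler_eq0 (negPf a0) orbF.
rewrite !mulf_eq0 invr_eq0 dot_self_eq0 (negPf a0) orbF pnatr_eq0 /=.
by move/eqP.
Qed.

(** A word is read from left to right as a composition of reflections, so its
    last letter acts first. *)
Definition word (s : seq V) : 'End(V) :=
  foldr (fun a f => reflection dp a \o f)%VF \1%VF s.

Lemma word_cons a s x : word (a :: s) x = reflection dp a (word s x).
Proof. exact: comp_lfunE. Qed.

Lemma word_cat s t x : word (s ++ t) x = word s (word t x).
Proof.
by elim: s => [|a s IH]; rewrite ?id_lfunE // cat_cons !word_cons IH.
Qed.

Lemma word_rcons s a x : word (rcons s a) x = word s (reflection dp a x).
Proof. by rewrite -cats1 word_cat word_cons id_lfunE. Qed.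

Lemma word_isometry s x y : dp (word s x) (word s y) = dp x y.
Proof.
by elim: s => [|a s IH]; rewrite ?id_lfunE // !word_cons reflection_isometry.
Qed.

Lemma word_revK s : cancel (word s) (word (rev s)).
Proof.
elim: s => [|a s IH] x; first by rewrite !id_lfunE.
by rewrite rev_cons word_rcons word_cons reflectionK IH.
Qed.

Lemma word_lker0 s : lker (word s) == 0%VS.
Proof. apply/lker0P; exact: can_inj (word_revK s). Qed.

Lemma word_inv s : ((word s)^-1)%VF = word (rev s).
Proof.
apply/lfunP => x; rewrite -{1}[x](word_revK (rev s)) revK.
by rewrite lker0_lfunK ?word_lker0.
Qed.

Lemma word_conj_reflection s a x :
  word s (reflection dp a x) = reflection dp (word s a) (word s x).
Proof. by rewrite !reflection_dotE linearB linearZ /= !word_isometry. Qed.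

Definition words (A : set V) : set 'End(V) :=
  [set word s | s in [set s : seq V | {in s, forall a, A a}]].

Lemma words_linear_group (A : set V) : linear_group (words A).
Proof.
split.
- by exists [::].
- move=> _ _ [s As <-] [t At <-]; exists (s ++ t).
    by move=> a; rewrite mem_cat => /orP[/As|/At].
  by apply/lfunP => x; rewrite word_cat comp_lfunE.
- move=> _ [s As <-]; split; first exact: word_lker0.
  by exists (rev s); rewrite ?word_inv // => a; rewrite mem_rev => /As.
Qed.

(** Reflections are involutions, so words are closed under inverses and already
    form the generated group. *)
Lemma generated_reflections (A : set V) :
  generated [set reflection dp a | a in A] = words A.
Proof.
apply/seteqP; split.
  apply: smallest_sub; first exact: words_linear_group.
  move=> _ [a Aa <-]; exists [:: a]; first by move=> b; rewrite inE => /eqP ->.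
  by apply/lfunP => x; rewrite word_cons id_lfunE.
move=> _ [s As <-] G [[G1 Gcomp _] subG].
elim: s As => [//|a s IH] As; apply: Gcomp.
  by apply: subG; exists a => //; apply: As; rewrite mem_head.
by apply: IH => b bs; apply: As; rewrite inE bs orbT.
Qed.

Lemma diag_act_word_rcons n s a (v : V ^ n) :
  diag_act (word (rcons s a)) v =
  diag_act (word s) (diag_act (reflection dp a) v).
Proof. by apply/ffunP => i; rewrite !ffunE word_rcons. Qed.

(** The target carries the module structure [R^o], so that [pairing v] is a
    linear map and the cone of lexicographically nonnegative rows is stable
    under its scaling. *)
Definition pairing n (v : V ^ n) (a : V) : R^o ^ n := [ffun i => dp (v i) a].

Lemma pairing_is_linear n (v : V ^ n) : linear (pairing v).
Proof.
by move=> c a b; apply/ffunP => i; rewrite !ffunE linearDr /= dotZr.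
Qed.

HB.instance Definition _ n (v : V ^ n) :=
  GRing.isLinear.Build R V (R^o ^ n)%type *:%R (pairing v) (pairing_is_linear v).

Lemma pairing_word n s (v : V ^ n) a :
  pairing (diag_act (word s) v) (word s a) = pairing v a.
Proof. by apply/ffunP => i; rewrite !ffunE word_isometry. Qed.

Lemma pairing_reflection n (v : V ^ n) a b :
  pairing (diag_act (reflection dp a) v) b = pairing v (reflection dp a b).
Proof. by apply/ffunP => i; rewrite !ffunE reflection_sym. Qed.

End Reflections.

(** * Cones over a free family *)

Section Cone.
Context {R : realType} {V : vectType R}.
Implicit Types (Pi : {fset V}) (a b : V).

Lemma scale_sum_fset Pi a (k : R) : a \in Pi ->
  k *: a = \sum_(d <- Pi) (k * (d == a)%:R) *: d.
Proof.
move=> aPi; rewrite (bigD1_seq a) ?fset_uniq //= eqxx mulr1 big1 ?addr0 // => b.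
by move=> /negPf ->; rewrite mulr0 scale0r.
Qed.

Lemma free_coef Pi (c d : V -> R) : free Pi ->
  \sum_(a <- Pi) c a *: a = \sum_(a <- Pi) d a *: a -> {in Pi, c =1 d}.
Proof.
move=> freePi cd; pose v := \sum_(a <- Pi) d a *: a.
have [|k _ kuniq] := free_span freePi (v := v).
  by rewrite /v big_seq rpred_sum // => a aPi; rewrite rpredZ // memv_span.
by move=> a aPi; rewrite (kuniq c) // (kuniq d).
Qed.

Lemma cone_gen Pi a : a \in Pi -> cone Pi a.
Proof.
move=> aPi; exists (fun b => 1 * (b == a)%:R) => [b _|].
  by rewrite mul1r ler0n.
by rewrite -scale_sum_fset // scale1r.
Qed.

Lemma dominant_cone n (dp : {dot V for idfun}) Pi (v : V ^ n) b :
  (forall a, a \in Pi -> lex_ge0 (pairing dp v a)) -> cone Pi b ->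
  lex_ge0 (pairing dp v b).
Proof.
move=> domv [c c0 ->]; rewrite linear_sum; apply: lex_ge0_sum => a aPi.
by rewrite linearZ; apply: lex_ge0Z; [exact: c0|exact: domv].
Qed.

End Cone.

(** * Simple systems and the chamber *)

Section SimpleSystem.
Context {R : realType} {V : vectType R}.
Variables (dp : {dot V for idfun}) (Phi Pi : {fset V}).
Hypotheses (Phi_root : root_system dp Phi) (Pi_simple : simple_system Phi Pi).
Implicit Types (a b x : V) (s t : seq V).

Let simple_root a : a \in Pi -> a \in Phi.
Proof. exact: simple_sub Pi_simple a. Qed.

Lemma root_nonzero a : a \in Phi -> a != 0.
Proof. by apply: contraTneq => ->; exact: root_neq0 Phi_root. Qed.

Lemma rootN a : a \in Phi -> - a \in Phi.
Proof.
move=> aPhi; rewrite -(reflection_root dp (root_nonzero aPhi)).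
exact: (root_reflection Phi_root).
Qed.

Lemma root_word s b : {in s, forall a, a \in Pi} -> b \in Phi ->
  word dp s b \in Phi.
Proof.
elim: s => [|a s IH] sPi bPhi; first by rewrite id_lfunE.
rewrite word_cons; apply: (root_reflection Phi_root).
  by apply/simple_root/sPi; rewrite mem_head.
by apply: IH => // d ds; apply: sPi; rewrite inE ds orbT.
Qed.

Lemma root_sign b : b \in Phi -> cone Pi b \/ cone Pi (- b).
Proof.
move=> bPhi; have : [set` Phi] b by [].
rewrite (simple_cover Pi_simple) => -[[_ ?]|[a [_ ?] <-]]; first by left.
by right; rewrite opprK.
Qed.

Lemma root_not_both b : b \in Phi -> cone Pi b -> ~ cone Pi (- b).
Proof.
move=> bPhi pb nb.
suff : (positive_roots Phi Pi `&` negative_roots Phi Pi) b.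
  by rewrite (simple_disjoint Pi_simple).
split; first by split.
by exists (- b); rewrite ?opprK //; split => //; exact: rootN.
Qed.

(** Subtracting a multiple of [a] from [b] changes only the coordinate at [a].
    A root [b <> a] in the cone is not a multiple of [a], so it has another
    positive coordinate, which [s_a b] keeps; hence [s_a b] is not negative. *)
Lemma simple_reflection_pos a b : a \in Pi -> b \in Phi -> cone Pi b ->
  b != a -> cone Pi (reflection dp a b).
Proof.
move=> aPi bPhi pb ba; have aPhi := simple_root aPi.
have [//|] := root_sign (root_reflection Phi_root aPhi bPhi).
rewrite reflection_dotE opprB; set k := _ / _ => -[e e0 be].
have [c c0 bc] := pb.
(* If both [b] and [k a - b] are in the cone, their coordinates away from [a]
   are nonnegative with zero sum. *)
have ce : {in Pi, forall d, c d + e d = k * (d == a)%:R}.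
  apply: (free_coef (simple_free Pi_simple)).
  rewrite -scale_sum_fset // -(subrK b (k *: a)) be bc -big_split /=.
  by apply: eq_bigr => d _; rewrite addrC scalerDl.
have bca : b = c a *: a.
  rewrite bc (scale_sum_fset (c a) aPi); apply: eq_big_seq => d dPi.
  have [->|da] := eqVneq d a; first by rewrite mulr1.
  rewrite mulr0; have /eqP := ce d dPi; rewrite (negPf da) mulr0.
  by rewrite paddr_eq0 ?c0 ?e0 // => /andP[/eqP ->].
have [|c1|c1] := root_reduced Phi_root (a := a) (c := c a) aPhi.
- by rewrite -bca.
- by move: ba; rewrite bca c1 scale1r eqxx.
- case: (root_not_both bPhi pb); rewrite bca c1 scaleN1r opprK.
  exact: cone_gen.
Qed.

(** Letters act from the right end of the word; at the letter [a] where the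
    image of [b] turns negative, that image must be [a], as [s_a] keeps all
    other positive roots positive. *)
Lemma sign_change s b : {in s, forall a, a \in Pi} -> b \in Phi ->
  cone Pi b -> cone Pi (- word dp s b) ->
  exists t a u, s = t ++ a :: u /\ word dp u b = a.
Proof.
move=> + bPhi pb; elim: s => [|a s IH] sPi.
  by rewrite id_lfunE => /(root_not_both bPhi pb).
have aPi : a \in Pi by apply: sPi; rewrite mem_head.
have {}sPi : {in s, forall a, a \in Pi}.
  by move=> d ds; apply: sPi; rewrite inE ds orbT.
have sbPhi := root_word sPi bPhi.
rewrite word_cons => nasb.
have [psb|/(IH sPi)[t [d [u [-> ud]]]]] := root_sign sbPhi; last first.
  by exists (a :: t), d, u.
exists [::], a, s; split=> //; apply/eqP/negP => /negP sba.
have := simple_reflection_pos aPi sbPhi psb sba.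
by move/(root_not_both (root_reflection Phi_root (simple_root aPi) sbPhi)).
Qed.

(** With [s = t b u] and [u a = b] one has [u s_a = s_b u], so the letter [b]
    cancels in [t s_b u s_a]. *)
Lemma exchange s a : {in s, forall a, a \in Pi} -> a \in Pi ->
  cone Pi (- word dp s a) ->
  exists t, [/\ {in t, forall a, a \in Pi}, (size t < size s)%N &
                word dp (rcons s a) = word dp t].
Proof.
move=> sPi aPi /(sign_change sPi (simple_root aPi) (cone_gen aPi)).
move=> [t [b [u [s_eq uab]]]]; exists (t ++ u); split.
- move=> d; rewrite mem_cat => dtu; apply: sPi.
  by rewrite s_eq mem_cat inE orbCA dtu orbT.
- by rewrite s_eq !size_cat /= addnS.
- apply/lfunP => x; rewrite s_eq word_rcons !word_cat word_cons.
  by rewrite (word_conj_reflection _ u) uab reflectionK.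
Qed.

(** This is the chamber tested on simple roots only; [chamber_n_dominant] shows
    that it is the recursively defined one. *)
Definition dominant n (v : V ^ n) : Prop :=
  forall a, a \in Pi -> lex_ge0 (pairing dp v a).

(** Reflecting in a simple root [a] on which [v] is negative makes the number of
    positive roots on which [v] is negative drop. *)
Lemma dominant_orbit n (v : V ^ n) :
  exists2 s, {in s, forall a, a \in Pi} & dominant (diag_act (word dp s) v).
Proof.
pose neg (v : V ^ n) :=
  [seq b <- Phi | `[< cone Pi b /\ ~ lex_ge0 (pairing dp v b) >]].
have [k] := ubnP (size (neg v)); elim: k v => // k IH v /ltnSE vk.
have [vdom|/existsNP[a /not_implyP[aPi nva]]] := pselect (dominant v).
  exists [::] => //; rewrite (_ : diag_act _ v = v) //.
  by apply/ffunP => i; rewrite ffunE id_lfunE.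
have aPhi := simple_root aPi; have a0 := root_nonzero aPhi.
have pva : lex_ge0 (pairing dp v (- a)).
  by rewrite linearN; case: (lex_ge0_total (pairing dp v a)).
have nega (b : V) : b \in neg (diag_act (reflection dp a) v) ->
    cone Pi b /\ reflection dp a b \in neg v.
  rewrite !mem_filter pairing_reflection => /andP[/asboolP[pb nvb] bPhi].
  have ba : b != a.
    by apply: contra_notN nvb => /eqP ->; rewrite reflection_root.
  split=> //; rewrite (root_reflection Phi_root) // andbT.
  by apply/asboolP; split => //; exact: simple_reflection_pos.
(* Reflection injects the negative roots of the new point into those of [v] and
   misses [a], which is one of the latter. *)
have [|s sPi sdom] := IH (diag_act (reflection dp a) v).
  apply: leq_trans vk; pose f := reflection dp a.
  set neg' := neg _; suff : (size (a :: map f neg') <= size (neg v))%N.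
    by rewrite /= size_map.
  apply: uniq_leq_size.
    rewrite /= map_inj_uniq ?filter_uniq ?fset_uniq ?andbT //; last first.
      exact: can_inj (reflectionK dp a).
    apply/mapP => -[b /nega[pb _]] /(congr1 f).
    rewrite /f reflectionK reflection_root // => ab.
    by apply: (root_not_both aPhi (cone_gen aPi)); rewrite ab.
  move=> d; rewrite inE => /predU1P[->|/mapP[b /nega[_ ?] -> //]].
  rewrite mem_filter aPhi andbT; apply/asboolP; split => //; exact: cone_gen.
exists (rcons s a); last by rewrite diag_act_word_rcons.
by move=> d; rewrite mem_rcons inE => /predU1P[->//|/sPi].
Qed.

(** Moving [- b] into the chamber makes [b] negative: a positive vector in the
    negative of the chamber would have nonpositive square norm. *)
Lemma positive_root_conj_simple b : b \in Phi -> cone Pi b ->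
  exists2 s, {in s, forall a, a \in Pi} & word dp s b \in Pi.
Proof.
move=> bPhi pb; have [s sPi sdom] := dominant_orbit [ffun _ : 'I_1 => - b].
have sbPhi := root_word sPi bPhi.
have [psb|] := root_sign sbPhi.
  have /(_ ord0) := dominant_cone sdom psb.
  rewrite !ffunE linearN linearNl /= oppr_ge0 leNgt neq0_dnorm_gt0 //.
    by move=> nonpos; have : false by apply: nonpos.
  exact: root_nonzero.
move=> /(sign_change sPi bPhi pb)[t [a [u [s_eq uba]]]].
exists u => [d du|]; first by apply: sPi; rewrite s_eq mem_cat inE du !orbT.
by rewrite uba; apply: sPi; rewrite s_eq mem_cat mem_head orbT.
Qed.

(** A root [b] with [s b] simple has [s_b = s^-1 s_(s b) s]. *)
Lemma weyl_group_words : weyl_group dp Phi = words dp [set` Pi].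
Proof.
apply/seteqP; split; last first.
  rewrite /weyl_group generated_reflections.
  apply: image_subset => s sPi a /sPi.
  exact: simple_root.
apply: smallest_sub; first exact: words_linear_group.
suff pos b : b \in Phi -> cone Pi b ->
    words dp [set` Pi] (reflection dp b).
  move=> _ [b bPhi <-]; have [|nb] := root_sign bPhi; first exact: pos.
  by rewrite -reflectionN; apply: pos => //; exact: rootN.
move=> bPhi pb; have [s sPi sbPi] := positive_root_conj_simple bPhi pb.
exists (rev s ++ word dp s b :: s).
  by move=> a; rewrite mem_cat inE mem_rev => /or3P[/sPi|/eqP ->|/sPi].
apply/lfunP => x.
by rewrite word_cat word_cons -word_conj_reflection word_revK.
Qed.

(** A last letter [a] with [s a] negative is removed by the exchange property.
    Otherwise dominance of [v] and of its image give opposite signs to the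
    pairing with [a], which therefore vanishes. *)
Lemma dominant_word_fix n s (v : V ^ n) : {in s, forall a, a \in Pi} ->
  dominant v -> dominant (diag_act (word dp s) v) ->
  diag_act (word dp s) v = v /\
  generated (orthogonal_simple_reflections dp Pi v) (word dp s).
Proof.
rewrite generated_reflections => + vdom.
have [k] := ubnP (size s); elim: k s => // k IH s /ltnSE sk.
case/lastP: s sk => [_ _ _|s a].
  split; first by apply/ffunP => i; rewrite ffunE id_lfunE.
  by exists [::].
rewrite size_rcons => sk saPi sadom.
have aPi : a \in Pi by apply: saPi; rewrite mem_rcons mem_head.
have sPi : {in s, forall a, a \in Pi}.
  by move=> d ds; apply: saPi; rewrite mem_rcons inE ds orbT.
have aPhi := simple_root aPi.
have saE : word dp (rcons s a) a = - word dp s a.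
  by rewrite word_rcons reflection_root ?root_nonzero // linearN.
have [psa|nsa] := root_sign (root_word sPi aPhi); last first.
  have [t [tPi ts eqt]] := exchange sPi aPi nsa.
  rewrite eqt in sadom *; apply: IH => //; exact: ltn_trans ts sk.
have va0 : pairing dp v a = 0.
  apply: lex_ge0_anti; first exact: vdom.
  rewrite -(pairing_word dp (rcons s a)) -linearN saE opprK.
  exact: dominant_cone sadom psa.
have vi0 i : dp a (v i) = 0.
  by rewrite dotC; move/ffunP/(_ i): va0; rewrite !ffunE.
have av : diag_act (reflection dp a) v = v.
  apply/ffunP => i; rewrite ffunE.
  apply/reflection_fix; first exact: root_nonzero.
  by rewrite dotC vi0.
rewrite diag_act_word_rcons av in sadom *.
have [-> [t tv ts]] := IH s sk sPi sadom; split=> //.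
exists (rcons t a).
  by move=> d; rewrite mem_rcons inE => /predU1P[->|/tv].
by apply/lfunP => x; rewrite !word_rcons ts.
Qed.

(** The reflection in [a] lies in the prefix stabiliser exactly when the leading
    pairings of [v] with [a] vanish, which is the premise of the lexicographic
    condition. *)
Lemma chamber_n_dominant n (v : V ^ n) : chamber_n dp Phi Pi v <-> dominant v.
Proof.
split=> [Cv a aPi m va0 | vdom m a [[aPhi [_ a_fix]] [_ pa]]].
  have aPhi := simple_root aPi.
  rewrite ffunE; apply: Cv; split; last by split=> //; exact: cone_gen.
  split=> //; split.
    by apply: sub_gen_smallest; exists a.
  move=> i /= im; split; first by apply: sub_gen_smallest; exists a.
  apply/reflection_fix; first exact: root_nonzero.
  by have := va0 i im; rewrite ffunE.
have := dominant_cone vdom pa (m := m); rewrite ffunE; apply => i im.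
rewrite ffunE; apply/(reflection_fix dp _ (root_nonzero aPhi)).
by have [] := a_fix i im.
Qed.

End SimpleSystem.

(** * The fundamental domain *)

Theorem theorem2p2 (R : realType) (V : vectType R) (dp : {dot V for idfun})
    (Phi Pi : {fset V}) (n : nat) :
  root_system dp Phi -> simple_system Phi Pi ->
  let W := weyl_group dp Phi in
  let C : set (V ^ n) := chamber_n dp Phi Pi in
  [/\ forall v : V ^ n, C v ->
        diag_stab W v = prefix_stab W v n /\
        prefix_stab W v n = generated (orthogonal_simple_reflections dp Pi v),
      forall v : V ^ n, exists! u : V ^ n, diag_orbit W v u /\ C u,
      convex_set (C : set (convex_lmodType (V ^ n)%type)) &
      connected (C : set (euclidean (V ^ n)%type))].
Proof.
move=> Phi_root Pi_simple W C.
have CE v : C v <-> dominant dp Pi v by exact: chamber_n_dominant.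
have WE : W = _ := weyl_group_words Phi_root Pi_simple.
have stabE (v : V ^ n) : diag_stab W v = prefix_stab W v n.
  apply/seteqP; split=> [w [Ww wv]|w [Ww w_fix]]; split=> //.
    by move=> i _; split => //; move/ffunP/(_ i): wv; rewrite ffunE.
  by apply/ffunP => i; rewrite ffunE; have [] := w_fix i (ltn_ord i).
have Cconv : convex_set (C : set (convex_lmodType (V ^ n)%type)).
  move=> x y l /set_mem/CE xdom /set_mem/CE ydom; apply/mem_set/CE => a aPi.
  rewrite (_ : pairing _ _ _ = (l%:num : R) *: pairing dp x a +
    (1 - l%:num : R) *: pairing dp y a); last first.
    by apply/ffunP => i; rewrite !ffunE linearDl /= !dotZl.
  apply: lex_ge0D; apply: lex_ge0Z; rewrite ?subr_ge0 //.
    exact: xdom.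
  exact: ydom.
split=> //; last exact: convex_connected.
- move=> v /CE vdom; split=> //; rewrite -stabE; apply/seteqP; split.
    move=> w []; rewrite WE => -[s sPi <-] sv.
    by have [] := dominant_word_fix Phi_root Pi_simple sPi vdom; rewrite ?sv.
  rewrite generated_reflections => _ [s sv <-]; split.
    by rewrite WE; exists s => // a /sv[].
  apply/ffunP => i; rewrite ffunE; elim: s sv => [|a s IH] sv.
    by rewrite id_lfunE.
  rewrite word_cons IH; last by move=> d ds; apply: sv; rewrite inE ds orbT.
  have [aPi av] := sv a (mem_head _ _).
  apply/reflection_fix; last by rewrite dotC av.
  exact: (root_nonzero Phi_root (simple_sub Pi_simple aPi)).
- move=> v; have [s sPi sdom] := dominant_orbit Phi_root Pi_simple v.
  exists (diag_act (word dp s) v); split.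
    by split; [exists (word dp s); rewrite // WE; exists s|exact/CE].
  move=> u [[w + wv] /CE]; rewrite WE => -[t tPi tw].
  rewrite -{u}wv -{w}tw => tdom.
  (* Both dominant points lie in one orbit, so one is a word applied to the
     other. *)
  have tE : diag_act (word dp t) v =
      diag_act (word dp (t ++ rev s)) (diag_act (word dp s) v).
    by apply/ffunP => i; rewrite !ffunE word_cat word_revK.
  rewrite tE in tdom *.
  have [|-> //] := dominant_word_fix Phi_root Pi_simple _ sdom tdom.
  by move=> a; rewrite mem_cat mem_rev => /orP[/tPi|/sPi].
Qed.
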